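(* Let $v_1,v_2,\dots,v_n$ be a basis of a vectorial matroid $M$ of rank $n$ whose ground set $S$ contains all the vectors $v_i-v_j$ for $1\le i\neq j\le n$. Then the matrix $A=(a_{ij})_{i,j=1}^n$, whose elements are $a_{ii}=v_1$ for $i=1,\dots,n$, and $a_{ij}=v_i-v_j$ for $1\le i\neq j\le n$, is a matroidal Latin square of order $n$ (over $M$) with no independent transversal of size $n$.
   Context: A vectorial matroid is a matroid whose ground set is a set of vectors in a vector space over a field, a subset being independent exactly when it is linearly independent. A matroidal Latin square (MLS) of degree (also called order) $n$ over a matroid $M$ with ground set $S$ is an $n\times n$ matrix $A$ whose entries are elements of $S$, where each row and each column of $A$ is a base of $M$ (so the $n$ entries of any single row or column are distinct; the same element of $S$ may occur in several cells of $A$ that lie in different rows and columns). An independent transversal of size $n$ of $A$ is an independent set of $n$ entries of $A$, no two of which lie in the same row or column of $A$; that is, it is given by $n$ cells, no two in the same row or column, whose entries are $n$ distinct elements of $S$ forming an independent set of $M$.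
   Formalization: The formal theorem assumes n ≥ 2; for n = 1 the matrix is (v_1), which has the independent transversal {v_1}, so the claim as stated fails there. *)

(* Defs.v *)
From mathcomp Require Import all_boot all_order all_algebra.
From mathcomp Require Import finmap.
From mathcomp Require Import classical_sets.

Set Implicit Arguments.
Unset Strict Implicit.
Unset Printing Implicit Defensive.

Import GRing.Theory.
Local Open Scope fset_scope.
Local Open Scope ring_scope.

(* The ground set may be infinite; [indep] ranges over finite sets only, which
   loses nothing for matroids of finite rank, as these have no infinite
   independent set. *)
Record matroid (T : choiceType) := Matroid {
  ground : set T;
  indep : {fset T} -> Prop;
  indep_ground : forall I : {fset T}, indep I -> forall x, x \in I -> ground x;
  indep0 : indep fset0;
  indepS : forall I J : {fset T}, I `<=` J -> indep J -> indep I;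
  indep_augment : forall I J : {fset T}, indep I -> indep J ->
    (#|` I| < #|` J|)%N ->
    exists x, [/\ x \in J, x \notin I & indep (x |` I)]
}.

Definition is_base (T : choiceType) (M : matroid T) (B : {fset T}) : Prop :=
  indep M B /\ forall I : {fset T}, indep M I -> B `<=` I -> I = B.

Definition has_rank (T : choiceType) (M : matroid T) (r : nat) : Prop :=
  (exists2 I : {fset T}, indep M I & #|` I| = r) /\
  (forall I : {fset T}, indep M I -> (#|` I| <= r)%N).

Definition is_base_family (T : choiceType) (M : matroid T) (n : nat)
    (f : 'I_n -> T) : Prop :=
  injective f /\ is_base M [fset f i | i in 'I_n].

Definition linearly_independent (F : fieldType) (V : lmodType F)
    (I : {fset V}) : Prop :=
  forall c : V -> F, \sum_(x <- I) c x *: x = 0 -> forall x, x \in I -> c x = 0.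

Definition vectorial (F : fieldType) (V : lmodType F) (M : matroid V) : Prop :=
  forall I : {fset V},
    indep M I <-> (forall x, x \in I -> ground M x) /\ linearly_independent I.

Definition matroidal_latin_square (T : choiceType) (M : matroid T) (n : nat)
    (A : 'M[T]_n) : Prop :=
  [/\ forall i j, ground M (A i j),
      forall i, is_base_family M (fun j => A i j)
    & forall j, is_base_family M (fun i => A i j)].

(* A transversal is a set [C] of cells (row, column), not of entries, since an
   element may occur in several cells. *)
Definition independent_transversal (T : choiceType) (M : matroid T) (n : nat)
    (A : 'M[T]_n) (k : nat) (C : {set 'I_n * 'I_n}) : Prop :=
  [/\ #|C| = k,
      {in C &, injective (fun c : 'I_n * 'I_n => c.1)},
      {in C &, injective (fun c : 'I_n * 'I_n => c.2)},
      {in C &, injective (fun c : 'I_n * 'I_n => A c.1 c.2)}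
    & indep M [fset A c.1 c.2 | c in C]].

(* Main.v *)
Require Import Defs.
From mathcomp Require Import all_boot all_order all_algebra.
From mathcomp Require Import finmap.
From mathcomp Require Import classical_sets.

(** In the basis [v], every difference [v i - v j] has coordinate sum 0 while
    [v1] has coordinate sum 1; comparing coordinate sums shows that each row and
    each column is a free family. On the other hand, the rows and the columns of
    the [n] cells of a transversal both run through all indices, so its
    off-diagonal entries sum to [\sum_i v i - \sum_j v j = 0]. Independence
    therefore leaves only diagonal cells, all with the same entry [v1],
    and [n > 1]. *)

Set Implicit Arguments.
Unset Strict Implicit.
Unset Printing Implicit Defensive.

Import GRing.Theory.
Local Open Scope ring_scope.

Section FreeFamilies.

Variables (F : fieldType) (V : lmodType F) (K : finType).
Implicit Types (D : {set K}) (f : K -> V).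

(** Coefficients sit on indices rather than on vectors, so a repeated vector already counts as a
    dependence. *)
Definition free_family D f : Prop :=
  forall c : K -> F, \sum_(k in D) c k *: f k = 0 -> {in D, forall k, c k = 0}.

(** Equal values at [a != b] would give a relation with coefficient 1 at [a] and -1 at [b]. *)
Lemma free_family_inj D f : free_family D f -> {in D &, injective f}.
Proof.
move=> free_f a b Da Db eq_f; apply/eqP/negPn/negP => neq_ab.
have /free_f/(_ a Da)/eqP :
    \sum_(k in D) ((k == a)%:R - (k == b)%:R) *: f k = 0 :> V.
  under eq_bigr do rewrite scalerBl !scaler_nat !mulrb.
  rewrite big_split /= sumrN -!big_mkcondr /=.
  rewrite (big_pred1 a) => [|k]; last by rewrite /= andbC; case: eqP => // ->.
  rewrite (big_pred1 b) => [|k]; last by rewrite /= andbC; case: eqP => // ->.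
  by rewrite eq_f subrr.
by rewrite eqxx (negbTE neq_ab) subr0 oner_eq0.
Qed.

Lemma linearly_independent_imfset D f : {in D &, injective f} ->
  linearly_independent [fset f k | k in D]%fset <-> free_family D f.
Proof.
move=> inj_f; split=> [indep_f c sum0 k Dk | free_f c].
(* [c'] carries [c] from indices to vectors along the inverse of [f] on [D], with default 0 off the
   image. *)
- pose c' x := if [pick k in D | f k == x] is Some k then c k else 0.
  have c'E k' : k' \in D -> c' (f k') = c k'.
    rewrite /c' => Dk'; case: pickP => [l /andP[Dl /eqP /inj_f -> //]|].
    by move=> /(_ k'); rewrite Dk' eqxx.
  rewrite -c'E //; apply: indep_f; last by apply/imfsetP; exists k.
  rewrite big_imfset //= big_enum -[RHS]sum0.
  by apply: eq_bigr => k' Dk'; rewrite c'E.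
- rewrite big_imfset //= big_enum => /free_f c0 x /imfsetP[k Dk ->].
  exact: c0.
Qed.

End FreeFamilies.

Section VectorialBases.

Variables (F : fieldType) (V : lmodType F) (M : matroid V).
Hypothesis vectM : vectorial M.
Variable n : nat.
Implicit Type f : 'I_n -> V.

Lemma imfset_ord_setT f :
  [fset f i | i in 'I_n]%fset = [fset f i | i in [set: 'I_n]]%fset.
Proof. by apply: eq_imfset => // i; rewrite !inE. Qed.

Lemma base_family_free f : is_base_family M f -> free_family [set: 'I_n] f.
Proof.
case=> inj_f [/vectM[_ indep_f] _]; apply/linearly_independent_imfset.
  exact: in2W.
by rewrite -imfset_ord_setT.
Qed.

(** Maximality is a count: the image already has [n] elements, and no independent set has more. *)
Lemma free_base_family f : has_rank M n -> (forall i, ground M (f i)) ->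
  free_family [set: 'I_n] f -> is_base_family M f.
Proof.
move=> [_ rankM] gr_f free_f; have inj_fT := free_family_inj free_f.
have inj_f : injective f by move=> i j; apply: inj_fT; rewrite inE.
split=> //; split=> [|I indepI sub_fI].
  apply/vectM; split=> [x /imfsetP[i _ ->] //|].
  by rewrite imfset_ord_setT; apply/linearly_independent_imfset.
apply/eqP; rewrite eq_sym eqEfcard sub_fI /=.
by rewrite card_imfset //= -cardE card_ord rankM.
Qed.

End VectorialBases.

(* The sign [e] covers rows ([e = 1]) and columns ([e = -1]) at once. *)
Lemma free_differences (F : fieldType) (V : lmodType F) (K : finType)
    (v : K -> V) (o i : K) (e : F) :
  e != 0 -> free_family [set: K] v ->
  free_family [set: K] (fun j => if j == i then v o else e *: (v i - v j)).
Proof.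
move=> e0 free_v c sum0; pose s := \sum_j c j.
have sumT (g : K -> V) : \sum_(k in [set: K]) g k = \sum_k g k.
  by apply: eq_bigl => k; rewrite inE.
have sum_delta (a : F) l : \sum_k a * (k == l)%:R = a.
  by rewrite (bigD1 l) //= eqxx mulr1 big1 ?addr0 // => k /negbTE->; rewrite mulr0.
have sum_deltav (a : F) l : \sum_k (a * (k == l)%:R) *: v k = a *: v l.
  rewrite (bigD1 l) //= eqxx mulr1 big1 ?addr0 // => k /negbTE->.
  by rewrite mulr0 scale0r.
(* [d k] is the coefficient of [v k] once the combination is expanded. The sum [s] may include
   [c i], because [v i - v i] vanishes. *)
pose d k := c i * (k == o)%:R + e * (s * (k == i)%:R - c k).
have d0 k : d k = 0.
  apply: (free_v d); rewrite ?inE // -[RHS]sum0 !sumT.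
  under eq_bigr do rewrite scalerDl -[(e * _) *: _]scalerA scalerBl.
  rewrite big_split /= sum_deltav -scaler_sumr sumrB sum_deltav scaler_suml -sumrB.
  rewrite scaler_sumr (bigD1 i) //= subrr scaler0 add0r.
  rewrite [RHS](bigD1 i) //= eqxx; congr (_ + _).
  by apply: eq_bigr => k' /negbTE->; rewrite -scalerBr !scalerA mulrC.
(* The coefficients [d k] add up to [c i + e * (s - s) = c i]. *)
have ci0 : c i = 0.
  have : \sum_k d k = 0 by apply: big1.
  by rewrite big_split /= sum_delta -mulr_sumr sumrB sum_delta subrr mulr0 addr0.
have dE k : s * (k == i)%:R - c k = 0.
  by have /eqP := d0 k; rewrite /d ci0 mul0r add0r mulf_eq0 (negbTE e0) => /eqP.
(* At [k = i] the relation [dE] reads [s - c i = 0]. *)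
have s0 : s = 0 by have := dE i; rewrite eqxx mulr1 ci0 subr0.
by move=> k _; have /eqP := dE k; rewrite s0 mul0r sub0r oppr_eq0 => /eqP.
Qed.

(** By counting, [p] maps [C] bijectively onto ['I_n], so the sum is merely reindexed. *)
Lemma sum_inj_full (W : nmodType) (n : nat) (K : finType) (C : {set K})
    (p : K -> 'I_n) (v : 'I_n -> W) :
  #|C| = n -> {in C &, injective p} -> \sum_(k in C) v (p k) = \sum_i v i.
Proof.
move=> cardC inj_p; rewrite -(big_imset v inj_p) /=.
suff -> : p @: C = [set: 'I_n] by apply: eq_bigl => i; rewrite inE.
by apply/eqP; rewrite eqEcard finset.subsetT card_in_imset // cardC cardsT card_ord leqnn.
Qed.

Theorem theorem3p1 (F : fieldType) (V : lmodType F) (M : matroid V)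
  (hM : vectorial M) (n : nat) (hn : (1 < n)%N) (hrank : has_rank M n)
  (v : 'I_n -> V) (hv : is_base_family M v)
  (hS : forall i j : 'I_n, i != j -> ground M (v i - v j)) :
  let v1 := v (Ordinal (ltnW hn)) in
  let A := \matrix_(i < n, j < n) (if i == j then v1 else v i - v j) in
  matroidal_latin_square M A /\
  ~ exists C : {set 'I_n * 'I_n}, independent_transversal M A n C.
Proof.
move=> v1 A; have free_v := base_family_free hM hv.
have gr_A i j : ground M (A i j).
  rewrite mxE; case: eqP => [_|/eqP/hS //]; have [_ [/indep_ground gr _]] := hv.
  by apply: gr; apply/imfsetP; exists (Ordinal (ltnW hn)).
split.
  split=> // i; apply: free_base_family => // c sum0.
  - apply: (free_differences (o := Ordinal (ltnW hn)) (i := i) (oner_neq0 F) free_v).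
    rewrite -[RHS]sum0; apply: eq_bigr => j _.
    by rewrite mxE eq_sym scale1r.
  - have e0 : (-1 : F) != 0 by rewrite oppr_eq0 oner_eq0.
    apply: (free_differences (o := Ordinal (ltnW hn)) (i := i) e0 free_v).
    rewrite -[RHS]sum0; apply: eq_bigr => j _.
    by rewrite mxE scaleN1r opprB.
case=> C [cardC inj1 inj2 injA /hM[_]].
move=> /(linearly_independent_imfset injA) free_A.
have diagC : {in C, forall c, c.1 = c.2}.
  (* The 0/1 coefficients discard the diagonal entries [v1]; there [v c.1 - v c.2] is 0 as well, so
     the difference formula holds on all of [C]. *)
  have sum0 : \sum_(c in C) (c.1 != c.2)%:R *: A c.1 c.2 = 0.
    transitivity (\sum_(c in C) (v c.1 - v c.2)).
      apply: eq_bigr => c _; rewrite mxE.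
      by case: eqP => [->|_]; rewrite ?scale0r ?subrr ?scale1r.
    by rewrite sumrB !(sum_inj_full v cardC) ?subrr.
  move=> c Cc; have /eqP := free_A _ sum0 c Cc.
  by case: (c.1 =P c.2) => //= _; rewrite oner_eq0.
(* Two distinct cells on the diagonal share the entry [v1], against [injA]. *)
have /card_gt1P[a [b [Ca Cb]]] : (1 < #|C|)%N by rewrite cardC.
by case/eqP; apply: injA => //=; rewrite !mxE !diagC ?eqxx.
Qed.
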